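(* Let $x\in E$. For any functional $F\in L^1(\mathbb Q_x)$, the process $\left(M(F,X_0,X_1,\dots,X_n)\right)_{n\ge0}$ is an $(\mathcal F_n)_{n\ge0}$-martingale under $\mathbb P_x$, with expectation $\mathbb Q_x(F)$.
   Context: $E$ is a countable set, $(X_n)_{n\ge0}$ the canonical process on $E^{\mathbb N}$, $\mathcal F_n=\sigma(X_0,\dots,X_n)$, $\mathcal F_\infty=\sigma(X_n,n\ge0)$. $(\mathbb P_x)_{x\in E}$ are the laws (expectations $\mathbb E_x$) of a time-homogeneous Markov chain with transition probabilities $(p_{y,z})$, $\mathbb P_x(X_0=x)=1$. Assumptions: for every $x$, $\{y:p_{x,y}>0\}$ is finite; for all $x,y$ there is $n\in\mathbb N$ with $\mathbb P_x(X_n=y)>0$; for every $x$ the canonical process is recurrent under $\mathbb P_x$. Fix $x_0\in E$ and $\phi:E\to\mathbb R_+$ such that $\phi(x_0)=0$, $\mathbb E_x[\phi(X_1)]=\phi(x)$ for all $x\ne x_0$, and $\phi$ is unbounded. For $r\in(0,1)$ let $\psi_r(x)=\frac r{1-r}\mathbb E_{x_0}[\phi(X_1)]+\phi(x)$. For $y\in E$, $L_k^y=\sum_{m=0}^k1_{X_m=y}$ $(k\ge0)$, $L_{-1}^y=0$, $L_\infty^y=\lim_kL_k^y$. $\mu_x^{(r)}$ is the finite measure on $(E^{\mathbb N},\mathcal F_\infty)$ with $\mu_x^{(r)}|_{\mathcal F_n}=\psi_r(X_n)r^{L_{n-1}^{x_0}}\cdot\mathbb P_x|_{\mathcal F_n}$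 for all $n$, and $\mathbb Q_x=r^{-L_\infty^{x_0}}\cdot\mu_x^{(r)}$, a $\sigma$-finite measure which does not depend on $r\in(0,1)$. For an $\mathcal F_\infty$-measurable functional $F$ (nonnegative, or $\mathbb Q_x$-integrable, the quantity below then being defined $\mathbb P_x$-a.s. along the chain) and $y_0,\dots,y_n\in E$, $$M(F,y_0,y_1,\dots,y_n)=\mathbb Q_{y_n}\left[F(y_0,y_1,\dots,y_n=X_0,X_1,X_2,\dots)\right],$$ i.e. $F$ is evaluated on the sequence $(y_0,\dots,y_{n-1},X_0,X_1,X_2,\dots)$, which is integrated under $\mathbb Q_{y_n}$ (where $X_0=y_n$). *)

(* Defs.v *)
From HB Require Import structures.
From mathcomp Require Import all_boot all_order all_algebra.
From mathcomp Require Import all_classical all_reals all_analysis.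
From mathcomp Require Import measurable_realfun.

Set Implicit Arguments.
Unset Strict Implicit.
Unset Printing Implicit Defensive.

Import Order.TTheory GRing.Theory Num.Theory.
Import numFieldNormedType.Exports.

Local Open Scope classical_set_scope.
Local Open Scope ring_scope.

(* The sets {X_k \in B}, k \in I, B any subset of E; the countable set E       *)
(* carries its discrete sigma-algebra.                                        *)
Definition coord_sets (E : Type) (I : set nat) : set (set (nat -> E)) :=
  \bigcup_(k in I) preimage_set_system setT (fun w : nat -> E => w k) setT.

Notation trajectory E := (g_sigma_algebraType (@coord_sets E setT)).

Definition coord_filtration (E : Type) (n : nat) : set (set (trajectory E)) :=
  <<s coord_sets [set k | (k <= n)%N] >>.

Section chain.
Context (E : pointedType) (R : realType).
Local Open Scope ereal_scope.

Definition transition_matrix (p : E -> E -> R) : Prop :=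
  (forall y z, (0 <= p y z)%R) /\
  (forall y, \esum_(z in [set: E]) (p y z)%:E = 1).

(* The second clause is P_x(X_{n+1} = z | F_n) = p_{X_n, z}, tested on the     *)
(* events A `&` {X_n = y} with A in F_n.                                      *)
Definition markov_law (p : E -> E -> R) (x : E)
    (Px : probability (trajectory E) R) : Prop :=
  Px [set w | w 0%N = x] = 1 /\
  (forall (n : nat) (y z : E) (A : set (trajectory E)), coord_filtration n A ->
     Px (A `&` [set w | w n = y] `&` [set w | w n.+1 = z]) =
     Px (A `&` [set w | w n = y]) * (p y z)%:E).

Definition irreducible (P : E -> probability (trajectory E) R) : Prop :=
  forall x y, exists n : nat, 0 < P x [set w | w n = y].

(* Under P_x, the starting point x is visited infinitely often a.s.           *)
Definition recurrent (P : E -> probability (trajectory E) R) : Prop :=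
  forall x, {ae P x, forall w : trajectory E,
    forall N : nat, exists2 n : nat, (N <= n)%N & w n = x}.

(* visits y n w is L_{n-1}^y: the visits to y strictly before time n.         *)
Definition visits (y : E) (n : nat) (w : trajectory E) : nat :=
  (\sum_(0 <= m < n) (w m == y))%N.

Definition total_visits (y : E) (w : trajectory E) : \bar R :=
  limn (fun n => (visits y n w)%:R%:E).

Definition psi (P : E -> probability (trajectory E) R) (x0 : E) (phi : E -> R)
    (r : R) (x : E) : \bar R :=
  (r / (1 - r))%:E * 'E_(P x0)[fun w => phi (w 1%N)] + (phi x)%:E.

Definition is_mu (P : E -> probability (trajectory E) R) (x0 : E) (phi : E -> R)
    (r : R) (x : E) (mu : {finite_measure set (trajectory E) -> \bar R}) : Prop :=
  forall (n : nat) (A : set (trajectory E)), coord_filtration n A ->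
    mu A = \int[P x]_(w in A)
             (psi P x0 phi r (w n) * (r ^+ visits x0 n w)%:E).

(* r ^ (- l) for 0 < r < 1 and l in [0, +oo]; the -oo case is junk.           *)
Definition expNr (r : R) (l : \bar R) : \bar R :=
  match l with
  | s%:E => (r `^ (- s))%:E
  | +oo => +oo
  | -oo => 0
  end.

Lemma expNr_ge0 (r : R) l : 0 <= expNr r l.
Proof. by case: l => //= s; rewrite lee_fin powR_ge0. Qed.

Lemma measurable_expNr (r : R) : measurable_fun setT (expNr r).
Proof.
rewrite (_ : expNr r = fun l => if l == +oo then +oo else
  if l == -oo then 0 else (r `^ (- fine l))%:E); last first.
  by apply/funext => -[].
have meq (a : \bar R) : measurable_fun [set: \bar R] (fun l => l == a).
  apply: (@measurable_fun_bool _ _ _ _ true).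
  rewrite setTI (_ : _ @^-1` _ = [set a]); first exact: emeasurable_set1.
  by apply/seteqP; split => x /= /eqP.
apply: measurable_fun_ifT => //; apply: measurable_fun_ifT => //.
apply/measurable_EFinP.
apply: (measurableT_comp (measurable_powRr r)).
apply: measurableT_comp => //; exact: measurable_fine.
Qed.

Lemma measurable_coord (n : nat) (B : set E) :
  measurable [set w : trajectory E | B (w n)].
Proof.
apply: sub_sigma_algebra; exists n => //; exists B => //.
by rewrite setTI.
Qed.

Lemma measurable_total_visits y : measurable_fun setT (total_visits y).
Proof.
apply: (emeasurable_fun_cvg (fun n w => (visits y n w)%:R%:E)).
  move=> n; apply/measurable_EFinP.
  rewrite (_ : (fun w => _) =
    fun w => (\sum_(0 <= m < n) ((w m == y) : nat)%:R)%R); last first.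
    by apply/funext => w; rewrite /visits natr_sum.
  apply: measurable_sum => m.
  rewrite (_ : (fun w => _) = \1_[set w : trajectory E | w m = y]).
    by apply: measurable_indic; exact: (measurable_coord m [set y]).
  apply/funext => w; rewrite indicE; congr (nat_of_bool _)%:R.
  by apply/eqP/idP; rewrite inE.
move=> w _; apply: ereal_nondecreasing_is_cvgn.
apply/nondecreasing_seqP => n; rewrite lee_fin ler_nat.
by rewrite /visits big_nat_recr//= leq_addr.
Qed.

Section Qmeasure.
Variables (r : R) (x0 : E) (mu : {measure set (trajectory E) -> \bar R}).

(* Q_x = r ^ (- L_infty^{x0}) . mu_x                                          *)
Definition Qmeasure (A : set (trajectory E)) : \bar R :=
  \int[mu]_(w in A) expNr r (total_visits x0 w).

Let Qmeasure0 : Qmeasure set0 = 0.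
Proof. by rewrite /Qmeasure integral_set0. Qed.

Let Qmeasure_ge0 A : 0 <= Qmeasure A.
Proof. by apply: integral_ge0 => w _; exact: expNr_ge0. Qed.

Let Qmeasure_semi_sigma_additive : semi_sigma_additive Qmeasure.
Proof.
apply: semi_sigma_additive_nng_induced => [|w]; last exact: expNr_ge0.
by apply: measurableT_comp;
  [exact: measurable_expNr|exact: measurable_total_visits].
Qed.

HB.instance Definition _ := isMeasure.Build _ _ _ Qmeasure
  Qmeasure0 Qmeasure_ge0 Qmeasure_semi_sigma_additive.

End Qmeasure.

(* (y_0, ..., y_{n-1}, w_0, w_1, ...); the last entry y_n is not used.        *)
Definition splice (n : nat) (y : n.+1.-tuple E) (w : trajectory E) : trajectory E :=
  fun k => if (k < n)%N then tnth y (inord k) else w (k - n)%N.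

Definition M (Q : E -> {measure set (trajectory E) -> \bar R})
    (F : trajectory E -> \bar R) (n : nat) (y : n.+1.-tuple E) : \bar R :=
  \int[Q (tnth y ord_max)]_w F (splice y w).

End chain.

Section martingale.
Context d (T : measurableType d) (R : realType).
Local Open Scope ereal_scope.

(* Extended-real values are allowed; integrability forces each Z_n to be      *)
(* finite almost surely.                                                      *)
Definition martingale (P : probability T R) (G : nat -> set (set T))
    (Z : nat -> T -> \bar R) : Prop :=
  [/\ forall n (B : set (\bar R)), measurable B -> G n (Z n @^-1` B),
      forall n, P.-integrable setT (Z n)
    & forall m n A, (m <= n)%N -> G m A ->
        \int[P]_(w in A) Z n w = \int[P]_(w in A) Z m w].

End martingale.

(* Main.v *)
Require Import Defs.
From HB Require Import structures.
From mathcomp Require Import all_boot all_order all_algebra.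
From mathcomp Require Import all_classical all_reals all_analysis.
From mathcomp Require Import measurable_realfun.

Set Implicit Arguments.
Unset Strict Implicit.
Unset Printing Implicit Defensive.

Import Order.TTheory GRing.Theory Num.Theory.
Import numFieldNormedType.Exports.

Local Open Scope classical_set_scope.
Local Open Scope ring_scope.
Local Open Scope ereal_scope.

(** A prefix (v_0, ..., v_n) is visible as the cylinder of the trajectories that
share it, and since E is countable, every event of F_n is a countable disjoint
union of such cylinders. Everything reduces to one identity between measures,
the Markov property of Q at time n:

  Q_x (A and C) = P_x (C) * Q_{v_n} {u | (v_0, ..., v_{n-1}, u_0, u_1, ...) in A}

for C the cylinder of v up to time n and A any event (lemma [Q_restart]). It
says that, under Q_x, a prefix has weight P_x (C) and the future is then drawn
from Q_{v_n}.

For the finite measures mu_x the same identity holds with the weight P_x (C)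
multiplied by r to the number of visits to x0 before time n ([mu_restart]): on a
cylinder longer than n both sides are explicit products of transition
probabilities, powers of r and one value of psi, and cylinders determine finite
measures. The density r ^ (- L_infty) that turns mu into Q is multiplicative
along the concatenation of a prefix and a future, and the factor that it
contributes for the prefix cancels exactly the extra power of r.

Integrating F >= 0 over the cylinder C gives, by that identity,
Q_x [F 1_C] = P_x (C) M(F, v_0, ..., v_n), which is the integral of
M(F, X_0, ..., X_n) over C under P_x. Summing over the cylinders that make up an
event A of F_n yields

  E_x [M(F, X_0, ..., X_n) 1_A] = Q_x [F 1_A],

whose right-hand side does not depend on n: this is the martingale property, and
A = the whole space gives the expectation. An integrable F is split into its
positive and negative parts ([integral_prefix_mean]). *)

(** * Integrals against a restricted measure that is an image measure *)

(** The measure structure of [pushforward m h] depends on a proof that h is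
measurable, which unification cannot guess: here it is an argument. *)
Definition image_measure d1 d2 (T1 : measurableType d1) (T2 : measurableType d2)
    (R : realType) (m : {measure set T1 -> \bar R}) (h : T1 -> T2)
    (mh : measurable_fun [set: T1] h) : {measure set T2 -> \bar R} :=
  measure_function_pushforward__canonical__measure_function_Measure m mh.

(** Taking for A the complement of C in the hypothesis shows that c * m2 ignores
the points that h sends outside of C, which is why the right-hand side ranges
over the preimage of B alone. *)
Lemma ge0_integral_restr_pushforward d1 d2 (T1 : measurableType d1)
    (T2 : measurableType d2) (R : realType)
    (m1 : {measure set T1 -> \bar R}) (m2 : {measure set T2 -> \bar R})
    (h : T2 -> T1) (c : {nonneg R}) (C : set T1) (f : T1 -> \bar R)
    (B : set T1) :
  measurable_fun [set: T2] h -> measurable C -> measurable B ->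
  (forall A, measurable A -> m1 (A `&` C) = c%:num%:E * m2 (h @^-1` A)) ->
  measurable_fun [set: T1] f -> (forall t, 0 <= f t) ->
  \int[m1]_(t in B `&` C) f t = c%:num%:E * \int[m2]_(s in h @^-1` B) f (h s).
Proof.
move=> mh mC mB m12 mf f0.
have mfB D : measurable_fun D f by exact: measurable_funS mf.
transitivity (\int[mrestr m1 mC]_(t in B `&` C) f t).
  apply: eq_measure_integral => A mA ABC.
  by rewrite /= /mrestr (setIidl (subset_trans ABC (@subIsetr _ _ _))).
transitivity (\int[mrestr m1 mC]_(t in B) f t).
  rewrite [RHS](@ge0_negligible_integral _ _ _ _ _ (~` C))//.
  - by rewrite setDE setCK.
  - exact: measurableC.
  - by rewrite /= /mrestr setICl measure0.
transitivity (\int[mscale c (image_measure m2 mh)]_(t in B) f t).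
  by apply: eq_measure_integral => A mA _; rewrite /= /mrestr m12.
rewrite ge0_integral_mscale//.
by rewrite ge0_integral_pushforward.
Qed.

(** * Cylinders and the coordinate filtration *)

Section prefixes.
Context (E : pointedType).
Implicit Types (v w u : trajectory E) (n k : nat).

Definition cylinder n v : set (trajectory E) :=
  [set w | forall k, (k <= n)%N -> w k = v k].

Definition prefix_determined n (A : set (trajectory E)) :=
  forall v w, cylinder n v w -> A v -> A w.

(** The entry [v n] is dropped: the future [w] supplies its own value at time n. *)
Definition paste n v w : trajectory E :=
  fun k => if (k < n)%N then v k else w (k - n)%N.

Lemma cylinder_sym n v w : cylinder n v w -> cylinder n w v.
Proof. by move=> vw k kn; rewrite vw. Qed.

Lemma cylinder_eq n v w : cylinder n v w -> cylinder n v = cylinder n w.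
Proof.
move=> vw; apply/seteqP; split => u uv k kn; rewrite uv// vw//.
Qed.

Lemma cylinder_filtration n v : coord_filtration n (cylinder n v).
Proof.
rewrite (_ : cylinder n v = \bigcap_(k in [set k | (k <= n)%N])
    [set w : trajectory E | w k = v k]); last first.
  by apply/seteqP; split.
apply: (@bigcap_measurableType _
  (g_sigma_algebraType (@coord_sets E [set k | (k <= n)%N]))) => k kn.
apply: sub_sigma_algebra; exists k => //; exists [set v k] => //.
by rewrite setTI.
Qed.

Lemma filtration_le m n : (m <= n)%N ->
  @coord_filtration E m `<=` coord_filtration n.
Proof.
move=> mn; apply: sub_sigma_algebra2 => A [k km Ak]; exists k => //=.
exact: leq_trans km mn.
Qed.

Lemma filtrationT n : coord_filtration n [set: trajectory E].
Proof.
exact: (@measurableT _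
  (g_sigma_algebraType (@coord_sets E [set k | (k <= n)%N]))).
Qed.

Lemma filtration_measurable n (A : set (trajectory E)) :
  coord_filtration n A -> measurable A.
Proof.
by move: A; apply: sub_sigma_algebra2 => A [k km Ak]; exists k.
Qed.

Lemma measurable_cylinder n v : measurable (cylinder n v).
Proof. exact: (@filtration_measurable n _ (@cylinder_filtration n v)). Qed.

(** The sets determined by the first n + 1 coordinates form a sigma-algebra that
contains the generators of F_n. *)
Lemma filtration_prefix_determined n (A : set (trajectory E)) :
  coord_filtration n A -> prefix_determined n A.
Proof.
move: A; apply: smallest_sub.
  split=> [v w //|A nA v w vw [_ nAv]|A nA v w vw [k _ Akv]].
    by split=> // Aw; apply: nAv; apply: nA Aw; exact: cylinder_sym.
  by exists k => //; exact: nA vw Akv.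
by move=> A [k kn [B _ <-]] v w vw [_ Bv]; split => //=; rewrite vw.
Qed.

Hypothesis E_countable : countable [set: E].

(** There are countably many prefixes of a given length: finite sequences over E
can be numbered. *)
Lemma prefix_code n : exists code : trajectory E -> nat,
  forall v w, code v = code w <-> cylinder n v w.
Proof.
have /countable_injP[e e_inj] := E_countable.
exists (fun w => pickle [seq e (w k) | k <- iota 0 n.+1]) => v w; split.
  move/(pcan_inj pickleK)/eq_in_map => vw k kn.
  by apply: e_inj; rewrite ?inE// vw// mem_iota.
move=> vw; congr pickle; apply/eq_in_map => k.
by rewrite mem_iota => /= kn; rewrite vw.
Qed.

(** The k-th piece is the part of A whose prefix has number k: it is empty when no
trajectory of A has such a prefix. *)
Lemma cylinder_partition n (A : set (trajectory E)) : prefix_determined n A ->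
  exists D : (set (trajectory E))^nat, [/\ A = \bigcup_k D k, trivIset setT D
    & forall k, D k = set0 \/ exists2 v, A v & D k = cylinder n v].
Proof.
move=> detA; have [code codeP] := prefix_code n.
exists (fun k => A `&` code @^-1` [set k]); split.
- by apply/seteqP; split => [w Aw|w [k _ []]//]; exists (code w).
- by move=> i j _ _ [w [[_ <-] [_ <-]]].
- move=> k; have [->|/set0P[v [Av vk]]] := eqVneq (A `&` code @^-1` [set k]) set0.
    by left.
  right; exists v => //; apply/seteqP; split => w.
    by move=> [Aw wk]; apply/codeP; rewrite vk wk.
  by move=> vw; split; [exact: detA vw Av|rewrite /= -vk; apply/esym/codeP].
Qed.

(** Together with [filtration_prefix_determined]: for countable E, belonging to
F_n is the same as depending only on the first n + 1 coordinates. *)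
Lemma prefix_determined_filtration n (A : set (trajectory E)) :
  prefix_determined n A -> coord_filtration n A.
Proof.
move/cylinder_partition => [D [-> _ DP]].
apply: (@bigcupT_measurable _
  (g_sigma_algebraType (@coord_sets E [set k | (k <= n)%N]))) => k.
case: (DP k) => [->|[v _ ->]]; first exact: sigma_algebra0.
exact: cylinder_filtration.
Qed.

Lemma eq_integral_cylinders (R : realType)
    (m1 m2 : {measure set (trajectory E) -> \bar R})
    (f g : trajectory E -> \bar R) n (A : set (trajectory E)) :
  measurable_fun setT f -> measurable_fun setT g ->
  (forall w, 0 <= f w) -> (forall w, 0 <= g w) ->
  (forall v, A v -> \int[m1]_(w in cylinder n v) f w =
                    \int[m2]_(w in cylinder n v) g w) ->
  coord_filtration n A -> \int[m1]_(w in A) f w = \int[m2]_(w in A) g w.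
Proof.
move=> mf mg f0 g0 fg /filtration_prefix_determined/cylinder_partition.
move=> [D [AD tD DP]].
have mD k : measurable (D k).
  by case: (DP k) => [->|[v _ ->]]//; exact: measurable_cylinder.
rewrite AD !ge0_integral_bigcup//; [|exact: measurable_funS mg..
  |exact: measurable_funS mf].
apply: eq_eseriesr => k _; case: (DP k) => [->|[v /fg ? ->]]//.
by rewrite !integral_set0.
Qed.

(** Measures of events are integrals of the constant 1, so the comparison of
integrals cylinder by cylinder applies to them. *)
Lemma eq_measure_cylinders (R : realType)
    (m1 m2 : {measure set (trajectory E) -> \bar R}) n
    (A : set (trajectory E)) :
  (forall v, A v -> m1 (cylinder n v) = m2 (cylinder n v)) ->
  coord_filtration n A -> m1 A = m2 A.
Proof.
move=> m12 nA; have mA := filtration_measurable nA.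
rewrite -[LHS]mul1e -[RHS]mul1e -!integral_cst//.
apply: eq_integral_cylinders nA => // v Av.
by rewrite !integral_cst ?m12//; exact: measurable_cylinder.
Qed.

End prefixes.

(** * Replacing the future of a trajectory *)

Section pasting.
Context (E : pointedType).
Implicit Types (v w u : trajectory E) (n k : nat).

Lemma preimage_paste_cylinder n k v u :
  paste n v @^-1` cylinder (n + k) (paste n v u) = cylinder k u.
Proof.
apply/seteqP; split => w /=; [move=> vu j jk|move=> uw j jnk]; last first.
  by rewrite /paste; case: ltnP => // nj; rewrite uw// leq_subLR.
have /(_ _)/= := vu (n + j)%N; rewrite /paste leq_add2l => /(_ jk).
by rewrite ltnNge leq_addr/= addKn.
Qed.

Lemma paste_shift n v u : cylinder n v u ->
  paste n v (fun j => u (n + j)%N) = u.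
Proof.
move=> vu; apply/funext => j; rewrite /paste; case: ltnP => jn.
  by rewrite vu// ltnW.
by rewrite subnKC.
Qed.

Lemma cylinder_paste n v u : u 0%N = v n -> cylinder n v (paste n v u).
Proof.
move=> u0 j; rewrite /paste leq_eqVlt => /predU1P[->|->//].
by rewrite ltnn subnn.
Qed.

Lemma measurable_paste n v :
  measurable_fun [set: trajectory E] (paste n v : trajectory E -> trajectory E).
Proof.
apply: (@measurability _ _ (trajectory E) (trajectory E) setT (paste n v)
  (@coord_sets E setT)) => //.
move=> _ [_ [k _ [B _ <-]] <-]; rewrite !setTI /preimage /paste/=.
case: ltnP => kn; last exact: (measurable_coord (k - n) B).
have [Bv|nBv] := pselect (B (v k)).
  by rewrite (_ : [set _ | _] = setT)//; apply/seteqP; split.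
by rewrite (_ : [set _ | _] = set0)//; apply/seteqP; split.
Qed.

Lemma splice_prefix n v w : splice [tuple v i | i < n.+1] w = paste n v w.
Proof.
apply/funext => k; rewrite /splice /paste; case: ltnP => // kn.
by rewrite tnth_mktuple inordK// ltnS ltnW.
Qed.

Lemma visits_paste (y : E) n k v u :
  visits y (n + k) (paste n v u) = (visits y n v + visits y k u)%N.
Proof.
rewrite /visits (@big_cat_nat _ _ _ n)//= ?leq_addr//; congr addn.
  rewrite [LHS]big_nat [RHS]big_nat; apply: eq_bigr => i /andP[_ ni].
  by rewrite /paste ni.
rewrite -{1}[n]add0n big_addn addKn; apply: eq_bigr => i _.
by rewrite /paste ltnNge leq_addl/= addnK.
Qed.

Lemma is_cvg_visits (R : realType) (y : E) u :
  cvgn (fun k => (visits y k u)%:R%:E : \bar R).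
Proof.
apply: ereal_nondecreasing_is_cvgn; apply/nondecreasing_seqP => k.
by rewrite lee_fin ler_nat /visits big_nat_recr//= leq_addr.
Qed.

Lemma total_visits_paste (R : realType) (y : E) n v u :
  total_visits R y (paste n v u) = (visits y n v)%:R%:E + total_visits R y u.
Proof.
rewrite /total_visits; apply/cvg_lim => //.
rewrite -(cvg_shiftn n).
rewrite [X in X @ _ --> _](_ : _ = fun k =>
  (visits y n v)%:R%:E + (visits y k u)%:R%:E :> \bar R); last first.
  by apply/funext => k; rewrite /= addnC visits_paste natrD.
apply: cvgeD; [by rewrite fin_num_adde_defr|exact: cvg_cst|].
exact: is_cvg_visits.
Qed.

Lemma total_visits_ge0 (R : realType) (y : E) u : 0 <= total_visits R y u.
Proof.
apply: lime_ge; last by apply: nearW => k; rewrite lee_fin.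
exact: is_cvg_visits.
Qed.

(** This cancels the power of r that mu gives to the visits of the prefix. *)
Lemma expNr_nat_add (R : realType) (r : R) (m : nat) (l : \bar R) :
  (0 < r)%R -> 0 <= l ->
  (r ^+ m)%:E * expNr r (m%:R%:E + l) = expNr r l.
Proof.
move=> r0; have rm0 : (0 < r ^+ m)%R by rewrite exprn_gt0.
case: l => [s _| _|//]; last by rewrite /= gt0_muley// lte_fin.
rewrite /= -EFinM; congr EFin.
rewrite opprD powRD; last by rewrite (gt_eqF r0) implybT.
by rewrite (powRN r m%:R) powR_mulrn ?(ltW r0)// mulrA divff ?mul1r// gt_eqF.
Qed.

End pasting.

(** * The restart identity for mu and for Q *)

Section chain_law.
Context (E : pointedType) (R : realType) (p : E -> E -> R)
  (P : E -> probability (trajectory E) R).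
Hypothesis P_markov : forall x, markov_law p x (P x).
Implicit Types (v w u : trajectory E) (n k : nat).

Lemma cylinder0_law v : P (v 0%N) (cylinder 0 v) = 1.
Proof.
have [<- _] := P_markov (v 0%N); congr (P _ _).
apply/seteqP; split => w /=; first exact.
by move=> w0 [].
Qed.

Lemma cylinderS_law x n v : P x (cylinder n.+1 v) =
  P x (cylinder n v) * (p (v n) (v n.+1))%:E.
Proof.
have [_ /(_ n (v n) (v n.+1) _ (@cylinder_filtration _ n v))] := P_markov x.
have -> : cylinder n v `&` [set w | w n = v n] = cylinder n v.
  by apply/seteqP; split => [w []//|w vw]; split => //; exact: vw.
move=> <-; congr (P _ _); apply/seteqP; split => w.
  by move=> vw; split => [k kn|]; [rewrite vw// ltnW|exact: vw].
by move=> [vw wn k]; rewrite leq_eqVlt ltnS => /predU1P[->//|/vw].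
Qed.

(** The Markov property on cylinders. The condition on [u 0] makes the two pieces
fit at time n, where both the prefix and the future prescribe the state. *)
Lemma cylinder_paste_law x n k v u : u 0%N = v n ->
  P x (cylinder (n + k) (paste n v u)) =
  P x (cylinder n v) * P (v n) (cylinder k u).
Proof.
move=> u0; elim: k => [|k IH].
  rewrite -u0 cylinder0_law mule1 addn0; congr (P x _).
  by apply/esym/cylinder_eq; exact: cylinder_paste.
rewrite addnS !cylinderS_law IH muleA /paste ltnNge leq_addr/= addKn.
by rewrite ltnNge (leq_trans (leq_addr k n) (leqnSn _))/= subSn ?leq_addr// addKn.
Qed.

Lemma cylinder_law0 x k u : u 0%N <> x -> P x (cylinder k u) = 0.
Proof.
move=> ux; have mx := @measurable_coord E 0 [set x].
have [Px _] := P_markov x.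
apply/eqP; rewrite eq_le measure_ge0 andbT.
have <- : P x (~` [set w | w 0%N = x]) = 0.
  by rewrite probability_setC// Px subee.
apply: le_measure; rewrite ?inE.
- exact: measurable_cylinder.
- exact: measurableC.
- by move=> w uw /= w0; apply: ux; rewrite -uw.
Qed.

Lemma cylinder_fin_num x n v : P x (cylinder n v) \is a fin_num.
Proof. by apply: fin_num_measure; exact: measurable_cylinder. Qed.

Section mu_law.
Variables (x0 : E) (phi : E -> R) (r : R)
  (mu : E -> {finite_measure set (trajectory E) -> \bar R}).
Hypotheses (E_countable : countable [set: E])
  (r_gt0 : (0 < r)%R)
  (mu_spec : forall x, is_mu P x0 phi r x (mu x)).

(** The density of mu_x on F_n is constant on cylinders of length n. *)
Lemma cylinder_mu x n v : mu x (cylinder n v) =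
  psi P x0 phi r (v n) * (r ^+ visits x0 n v)%:E * P x (cylinder n v).
Proof.
rewrite (mu_spec x (@cylinder_filtration _ n v)).
rewrite -integral_cst; last exact: measurable_cylinder.
apply: eq_integral => w; rewrite inE => vw; rewrite vw//=.
congr (_ * (_ ^+ _)%:E); rewrite /visits [LHS]big_nat [RHS]big_nat.
by apply: eq_bigr => i /andP[_ ni]; rewrite vw// ltnW.
Qed.

(** The mass that mu_x attaches to the prefix: its mu_x-measure without the factor
psi (v n), which belongs to the future. *)
Definition prefix_weight x n v : R :=
  (r ^+ visits x0 n v * fine (P x (cylinder n v)))%R.

Lemma prefix_weight_ge0 x n v : (0 <= prefix_weight x n v)%R.
Proof. by rewrite mulr_ge0 ?fine_ge0// exprn_ge0// ltW. Qed.

Lemma cylinder_paste_mu x n k v u : u 0%N = v n ->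
  mu x (cylinder (n + k) (paste n v u)) =
  (prefix_weight x n v)%:E * mu (v n) (cylinder k u).
Proof.
move=> u0; rewrite !cylinder_mu cylinder_paste_law// visits_paste exprD.
rewrite (_ : paste n v u (n + k)%N = u k); last first.
  by rewrite /paste ltnNge leq_addr/= addKn.
rewrite /prefix_weight !EFinM fineK ?cylinder_fin_num//.
rewrite !muleA; congr (_ * _); rewrite -!muleA muleCA; congr (_ * _).
by rewrite [RHS]muleCA; congr (_ * _); rewrite muleC.
Qed.

(** Both sides are finite measures in A, so it is enough to compare them on the
pi-system of all the events of F_{n+k}, k >= 0, and there on cylinders. A
cylinder compatible with v is handled by [cylinder_paste_mu]. An incompatible
one does not meet the cylinder of v, and its preimage consists of futures that
do not start at v n, which are null for mu_{v n}. *)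
Lemma mu_restart x n v (A : set (trajectory E)) : measurable A ->
  mu x (A `&` cylinder n v) =
  (prefix_weight x n v)%:E * mu (v n) (paste n v @^-1` A).
Proof.
have mC := @measurable_cylinder _ n v.
pose c := NngNum (prefix_weight_ge0 x n v).
pose m1 : {measure set (trajectory E) -> \bar R} := mrestr (mu x) mC.
pose m2 : {measure set (trajectory E) -> \bar R} :=
  mscale c (image_measure (mu (v n)) (@measurable_paste E n v)).
pose G := \bigcup_k @coord_filtration E (n + k).
have GT : G setT by exists 0%N => //; exact: filtrationT.
move=> mA; suff : m1 A = m2 A by [].
apply: (@measure_unique _ _ _ G (fun=> setT)) mA => //.
- apply/seteqP; split; last first.
    apply: smallest_sub; first exact: sigma_algebra_measurable.
    by move=> B [k _ kB]; exact: filtration_measurable kB.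
  apply: sub_sigma_algebra2 => B [k _ kB]; exists k => //.
  by apply: sub_sigma_algebra; exists k => //=; exact: leq_addl.
- move=> B1 B2 [k1 _ GB1] [k2 _ GB2]; exists (maxn k1 k2) => //.
  apply: (@measurableI _
    (g_sigma_algebraType (@coord_sets E [set k | (k <= n + maxn k1 k2)%N]))).
    by apply: filtration_le GB1; rewrite leq_add2l leq_maxl.
  by apply: filtration_le GB2; rewrite leq_add2l leq_maxr.
- by rewrite bigcup_const.
- move=> B [k _]; apply: eq_measure_cylinders => // u _.
  rewrite /= /mrestr /mscale/= /pushforward.
  have [vu|nvu] := pselect (cylinder n v u).
    (* The cylinder of u refines that of v: both sides are explicit. *)
    rewrite setIidl; last first.
      by move=> w uw j jn; rewrite uw ?vu// (leq_trans jn)// leq_addr.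
    rewrite -(paste_shift vu) cylinder_paste_mu ?addn0 ?vu//.
    by rewrite preimage_paste_cylinder.
  rewrite [X in mu x X](_ : _ = set0); last first.
    apply/seteqP; split => // w [uw vw]; apply: nvu => j jn.
    by rewrite -vw// uw// (leq_trans jn)// leq_addr.
  rewrite measure0; apply/esym.
  have [->|/set0P[w uw]] := eqVneq (paste n v @^-1` cylinder (n + k) u) set0.
    by rewrite measure0 mule0.
  (* Any future w compatible with u starts away from v n. *)
  rewrite (cylinder_eq uw) preimage_paste_cylinder.
  rewrite cylinder_mu cylinder_law0 ?mule0// => w0; apply: nvu => j jn.
  by rewrite -(cylinder_paste w0)// uw// (leq_trans jn)// leq_addr.
- by move=> _; rewrite /m1/= /mrestr setTI ltey_eq fin_num_measure.
Qed.

(** Integrating the density r ^ (- L_infty) in [mu_restart]: its factor over the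
prefix leaves only P_x of the cylinder out of [prefix_weight]. *)
Lemma Q_restart x n v (A : set (trajectory E)) : measurable A ->
  Qmeasure r x0 (mu x) (A `&` cylinder n v) =
  P x (cylinder n v) * Qmeasure r x0 (mu (v n)) (paste n v @^-1` A).
Proof.
move=> mA; rewrite /Qmeasure.
have md : measurable_fun setT
    (fun w : trajectory E => expNr r (total_visits R x0 w)).
  by apply: measurableT_comp;
    [exact: measurable_expNr|exact: measurable_total_visits].
rewrite (@ge0_integral_restr_pushforward _ _ _ _ _ _ (mu (v n)) (paste n v)
  (NngNum (prefix_weight_ge0 x n v)))//; first last.
- by move=> w; exact: expNr_ge0.
- by move=> B mB; exact: mu_restart.
- exact: measurable_cylinder.
- exact: measurable_paste.
rewrite /= /prefix_weight mulrC EFinM fineK ?cylinder_fin_num// -muleA.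
congr (_ * _); rewrite -ge0_integralZl_EFin//; first last.
- by rewrite exprn_ge0// ltW.
- apply: measurable_funTS.
  exact: (measurableT_comp md (@measurable_paste E n v)).
- by move=> w _; exact: expNr_ge0.
- by rewrite -[_ @^-1` _]setTI; exact: measurable_paste.
apply: eq_integral => w _.
by rewrite total_visits_paste expNr_nat_add ?total_visits_ge0.
Qed.

End mu_law.
End chain_law.

(** * Means of a functional given a prefix *)

Section conditional_mean.
Context (E : pointedType) (R : realType)
  (Q : E -> {measure set (trajectory E) -> \bar R}).
Implicit Types (v w : trajectory E) (F : trajectory E -> \bar R) (n : nat).

(** The process of the theorem: M(F, X_0, ..., X_n) as a function of the
trajectory. *)
Definition prefix_mean F n w : \bar R := M Q F [tuple w i | i < n.+1].

Lemma prefix_meanE F n w :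
  prefix_mean F n w = \int[Q (w n)]_u F (paste n w u).
Proof.
rewrite /prefix_mean /M tnth_mktuple/=.
by apply: eq_integral => u _; rewrite splice_prefix.
Qed.

Lemma prefix_mean_cylinder F n v w : cylinder n v w ->
  prefix_mean F n w = prefix_mean F n v.
Proof.
move=> vw; rewrite /prefix_mean; congr M.
by apply: eq_mktuple => i; rewrite vw// -ltnS.
Qed.

Lemma prefix_mean_ge0 F n w : (forall u, 0 <= F u) -> 0 <= prefix_mean F n w.
Proof. by move=> F0; apply: integral_ge0 => u _. Qed.

Lemma prefix_mean_posneg F n w :
  prefix_mean F n w = prefix_mean F^\+ n w - prefix_mean F^\- n w.
Proof.
rewrite !prefix_meanE [LHS]integralE.
by congr (_ - _); apply: eq_integral => u _; rewrite ?funeposE ?funenegE.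
Qed.

Lemma measurable_paste_comp F n w : measurable_fun setT F ->
  measurable_fun [set: trajectory E] (fun u : trajectory E => F (paste n w u)).
Proof. by move=> mF; exact: (measurableT_comp mF (@measurable_paste E n w)). Qed.

Lemma le_abse_prefix_mean F n w : measurable_fun setT F ->
  `|prefix_mean F n w| <= prefix_mean (abse \o F) n w.
Proof.
move=> mF; rewrite !prefix_meanE.
by apply: le_abse_integral => //; exact: measurable_paste_comp.
Qed.

Hypothesis E_countable : countable [set: E].

(** The process at time n is a function of the prefix, and every set of prefixes
is an event of F_n. *)
Lemma prefix_mean_adapted F n (B : set (\bar R)) :
  coord_filtration n (prefix_mean F n @^-1` B).
Proof.
apply: prefix_determined_filtration => // v w vw /=.
by rewrite (prefix_mean_cylinder _ vw).
Qed.

Lemma measurable_prefix_mean F n : measurable_fun setT (prefix_mean F n).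
Proof.
move=> _ B mB; rewrite setTI.
exact: (@filtration_measurable _ n _ (@prefix_mean_adapted F n B)).
Qed.

Variables P m : {measure set (trajectory E) -> \bar R}.
Hypothesis P_cyl : forall n v, P (cylinder n v) \is a fin_num.
Hypothesis restart : forall n v (A : set (trajectory E)), measurable A ->
  m (A `&` cylinder n v) = P (cylinder n v) * Q (v n) (paste n v @^-1` A).

(** On a cylinder the prefix mean is constant, so its integral is the mean times
the mass of the cylinder, which is the integral of F by the restart identity. *)
Lemma ge0_integral_prefix_mean F n (A : set (trajectory E)) :
  measurable_fun setT F -> (forall w, 0 <= F w) -> coord_filtration n A ->
  \int[P]_(w in A) prefix_mean F n w = \int[m]_(w in A) F w.
Proof.
move=> mF F0; apply: eq_integral_cylinders => //.
- exact: measurable_prefix_mean.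
- by move=> w; exact: prefix_mean_ge0.
move=> v _; have mC := @measurable_cylinder _ n v.
transitivity (\int[P]_(w in cylinder n v) cst (prefix_mean F n v) w).
  by apply: eq_integral => w; rewrite inE => /(prefix_mean_cylinder F).
rewrite integral_cst// prefix_meanE muleC -[cylinder n v in RHS]setTI.
have P0 : (0 <= fine (P (cylinder n v)))%R by exact: fine_ge0.
rewrite (@ge0_integral_restr_pushforward _ _ _ _ _ _ (Q (v n)) (paste n v)
  (NngNum P0))//=.
- by rewrite fineK.
- exact: measurable_paste.
- by move=> B mB; rewrite restart//= fineK.
Qed.

(** The absolute value of the mean is at most the mean of |F|, whose integral is
that of |F| under m. *)
Lemma prefix_mean_integrable F n :
  m.-integrable setT F -> P.-integrable setT (prefix_mean F n).
Proof.
move=> /integrableP[mF intF]; apply/integrableP; split.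
  exact: measurable_prefix_mean.
apply: le_lt_trans intF.
have maF : measurable_fun setT (abse \o F) by exact: measurableT_comp.
have nT := @filtrationT E n.
rewrite -[leRHS](@ge0_integral_prefix_mean (abse \o F) n)//; last first.
  by move=> w; exact: abse_ge0.
apply: ge0_le_integral => //.
- by apply: measurableT_comp => //; exact: measurable_prefix_mean.
- exact: measurable_prefix_mean.
- by move=> w _; exact: le_abse_prefix_mean.
Qed.

(** Prefix means may be infinite, but they are integrable, which licenses the
subtraction of the integrals of the means of the two parts of F. *)
Lemma integral_prefix_mean F n (A : set (trajectory E)) :
  m.-integrable setT F -> coord_filtration n A ->
  \int[P]_(w in A) prefix_mean F n w = \int[m]_(w in A) F w.
Proof.
move=> iF nA; have mA := @filtration_measurable _ n _ nA.
have mF : measurable_fun setT F := measurable_int _ iF.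
have iZ G : m.-integrable setT G -> P.-integrable A (prefix_mean G n).
  by move=> /(@prefix_mean_integrable G n); exact: integrableS.
transitivity (\int[P]_(w in A) (prefix_mean F^\+ n w - prefix_mean F^\- n w)).
  by apply: eq_integral => w _; exact: prefix_mean_posneg.
rewrite [RHS]integralE.
rewrite integralB//; [|exact/iZ/integrable_funepos|exact/iZ/integrable_funeneg].
by rewrite !ge0_integral_prefix_mean//;
  [exact: measurable_funeneg|exact: measurable_funepos].
Qed.

End conditional_mean.

(** * The martingale *)

Theorem corollary4p2p2 (R : realType) (E : pointedType)
  (E_countable : countable [set: E])
  (p : E -> E -> R) (p_transition : transition_matrix p)
  (P : E -> probability (trajectory E) R)
  (P_markov : forall x, markov_law p x (P x))
  (p_finite : forall x, finite_set [set y | (0 < p x y)%R])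
  (P_irreducible : irreducible P)
  (P_recurrent : recurrent P)
  (x0 : E) (phi : E -> R)
  (phi_ge0 : forall x, (0 <= phi x)%R)
  (phi_x0 : phi x0 = 0%R)
  (phi_harmonic : forall x, x != x0 ->
     'E_(P x)[fun w => phi (w 1%N)] = (phi x)%:E)
  (phi_unbounded : forall C : R, exists x, (C < phi x)%R)
  (r : R) (r_gt0 : (0 < r)%R) (r_lt1 : (r < 1)%R)
  (mu : E -> {finite_measure set (trajectory E) -> \bar R})
  (mu_spec : forall x, is_mu P x0 phi r x (mu x))
  (x : E) (F : trajectory E -> \bar R) :
  let Q : E -> {measure set (trajectory E) -> \bar R} :=
    fun y => Qmeasure r x0 (mu y) in
  let Z := fun (n : nat) (w : trajectory E) => M Q F [tuple w i | i < n.+1] in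
  (Q x).-integrable setT F ->
  martingale (P x) (@coord_filtration E) Z /\
  (forall n, \int[P x]_w Z n w = \int[Q x]_w F w).
Proof.
move=> Q Z iF.
have P_fin n v : P x (cylinder n v) \is a fin_num by exact: cylinder_fin_num.
have Q_cyl n v (A : set (trajectory E)) : measurable A ->
    Q x (A `&` cylinder n v) = P x (cylinder n v) * Q (v n) (paste n v @^-1` A).
  exact: (Q_restart P_markov E_countable r_gt0 mu_spec).
have ZF n (A : set (trajectory E)) : coord_filtration n A ->
    \int[P x]_(w in A) Z n w = \int[Q x]_(w in A) F w.
  exact: (integral_prefix_mean E_countable P_fin Q_cyl iF).
split; last first.
  by move=> n; apply: ZF; exact: filtrationT.
split=> [n B _|n|k n A kn kA].
- exact: (prefix_mean_adapted Q E_countable F).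
- exact: (prefix_mean_integrable E_countable P_fin Q_cyl n iF).
- by rewrite !ZF//; exact: filtration_le kA.
Qed.
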